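(* Let $w$ be a word with $|w|=n$, $\mathrm{alph}(w)=\Sigma$ and $\Sigma=\{1,2,\ldots,\sigma\}$ (with $\sigma\le n$), and let $k$ be an integer with $k\le \iota(w)\le n/\sigma$. The minimal number of letter deletions needed to obtain from $w$ a word of universality index $k$ (with respect to $\Sigma$) can be computed in $O(nk)$ time.
   Context: Computational model: unit-cost word RAM with memory words of $\log n$ bits for inputs of size $n$; the input word is over an integer alphabet $\{1,\ldots,\sigma\}$ with $\sigma\le n$ and contains at least two distinct letters. For a word $w$, $\mathrm{alph}(w)$ is the set of letters occurring in $w$. A word $v=v_1\cdots v_\ell$ is a subsequence of $w$ if $w=x_1v_1x_2v_2\cdots x_\ell v_\ell x_{\ell+1}$ for some words $x_i$. A word $u$ is $k$-universal with respect to $\Sigma$ if every word of length $k$ over $\Sigma$ is a subsequence of $u$; the universality index of $u$ (with respect to $\Sigma$) is the largest $k$ such that $u$ is $k$-universal, and $\iota(w)$ denotes the universality index of $w$ with respect to $\mathrm{alph}(w)$. A deletion removes one letter from the word.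
   Formalization: The integer k is taken to be non-negative, the time bound is O(n·max(1,k)), since O(nk) would allow no steps at all for k = 0, and memory words have log n + O(1) bits so that the input and linear-size arrays can be addressed. *)

(* Defs.v *)
From mathcomp Require Import all_boot.

Set Implicit Arguments.
Unset Strict Implicit.
Unset Printing Implicit Defensive.

Definition alph (w : seq nat) : seq nat := undup w.

Definition universal (S : seq nat) (k : nat) (u : seq nat) : Prop :=
  forall v : seq nat, size v = k -> {subset v <= S} -> subseq v u.

Definition universality_index (S u : seq nat) (k : nat) : Prop :=
  universal S k u /\ (forall m : nat, universal S m u -> m <= k).

Inductive deletions : nat -> seq nat -> seq nat -> Prop :=
| Deletions0 u : deletions 0 u u
| DeletionsS m x a y u :
    deletions m (x ++ y) u -> deletions m.+1 (x ++ a :: y) u.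

Definition min_deletions (S w : seq nat) (k m : nat) : Prop :=
  (exists2 u : seq nat, deletions m w u & universality_index S u k) /\
  (forall (m' : nat) (u : seq nat),
     deletions m' w u -> universality_index S u k -> m <= m').

(* Unit-cost word RAM with [b]-bit words. Register names and jump targets are
   literals of the program text, so a program uses finitely many registers;
   memory is addressed indirectly through registers. *)

Inductive binop :=
  Add | Sub | Mul | Div | Mod | And | Or | Xor | Shl | Shr | Eq | Lt.

Inductive instr :=
| Const (r c : nat)            (* r := c *)
| Op (o : binop) (r s t : nat) (* r := s o t *)
| Read (r s : nat)             (* r := memory[s] *)
| Write (r s : nat)            (* memory[r] := s *)
| Jump (l : nat)
| JumpIf (r l : nat)           (* jump to l if r is nonzero *)
| Halt.

Definition program := seq instr.

Record config := Config { pc : nat; reg : nat -> nat; mem : nat -> nat }.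

Definition upd (f : nat -> nat) (i x : nat) : nat -> nat :=
  fun j => if j == i then x else f j.

(* For operands [x, y < 2 ^ b]; the result is reduced modulo [2 ^ b] in
   [step], so [Sub] is subtraction modulo [2 ^ b]. *)
Definition eval_op (b : nat) (o : binop) (x y : nat) : nat :=
  match o with
  | Add => x + y
  | Sub => x + (2 ^ b - y)
  | Mul => x * y
  | Div => x %/ y
  | Mod => x %% y
  | And => Nat.land x y
  | Or  => Nat.lor x y
  | Xor => Nat.lxor x y
  | Shl => x * 2 ^ y
  | Shr => x %/ 2 ^ y
  | Eq  => x == y
  | Lt  => x < y
  end.

(* Running off the end of the program halts. *)
Definition fetch (P : program) (c : config) : instr := nth Halt P (pc c).

Definition step (b : nat) (P : program) (c : config) : config :=
  let: Config p r m := c in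
  match fetch P c with
  | Const i x    => Config p.+1 (upd r i (x %% 2 ^ b)) m
  | Op o i s t   => Config p.+1 (upd r i (eval_op b o (r s) (r t) %% 2 ^ b)) m
  | Read i s     => Config p.+1 (upd r i (m (r s))) m
  | Write i s    => Config p.+1 r (upd m (r i) (r s))
  | Jump l       => Config l r m
  | JumpIf i l   => Config (if r i != 0 then l else p.+1) r m
  | Halt         => c
  end.

Definition halted (P : program) (c : config) : Prop :=
  if fetch P c is Halt then True else False.

(* The input occupies the memory cells 0, 1, ...; all else starts at 0. *)
Definition init (input : seq nat) : config :=
  Config 0 (fun _ => 0) (nth 0 input).

(* The output is the content of register 0 at halting time. *)
Definition computes_within
    (b : nat) (P : program) (input : seq nat) (time output : nat) : Prop :=
  exists t : nat, [/\ t <= time,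
    halted P (iter t (step b P) (init input)) &
    reg (iter t (step b P) (init input)) 0 = output].

(* [(trunc_log 2 n).+1] is the length of the binary representation of [n > 0];
   the constant [e] leaves room to address a constant number of arrays of
   length [n] in the flat memory. *)
Definition word_length (e n : nat) : nat := (trunc_log 2 n).+1 + e.

(* Main.v *)
(** Deleting one letter lowers the universality index by at most one, so the
    task is to find the fewest deletions after which some word of length
    [k + 1] is avoided, that is, no longer a subsequence. Let [M t p] be the
    least number of deletions in the prefix of length [p] after which some word
    of length [t] is avoided ([M 0 p] is infinite), and [G t p a] the same for
    words of length [t + 1] ending with [a]. Reading the letter [a] at position
    [p] changes [G t p a] to [min (G t p a + 1) (M t p)] and no other value, and
    [M (t + 1) p] is the minimum of [G t p a] over [a]. Since
    [G t p a <= M t p], the update is an increment by at most one, so the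
    minimum is maintained in constant time by counting, for every [d], the
    letters whose value is at least [d]; thus each of the [k + 1] rounds takes
    linear time. *)

Require Import Defs.
From mathcomp Require Import all_boot zify.

Set Implicit Arguments.
Unset Strict Implicit.
Unset Printing Implicit Defensive.

(** * Deletions avoiding a set of words *)

Section Avoidance.

Variable T : eqType.
Implicit Types (S u v w x y : seq T) (L : seq T -> Prop).
Implicit Types (a b : T) (c d t : nat).

Lemma subseq_rcons2 u v a b :
  subseq (rcons u a) (rcons v b) =
  if a == b then subseq u v else subseq (rcons u a) v.
Proof.
rewrite -subseq_rev !rev_rcons /=; case: eqP => _; first exact: subseq_rev.
by rewrite -rev_rcons subseq_rev.
Qed.

Lemma subseq_rcons_inv u v b :
  subseq u (rcons v b) ->
  subseq u v \/ exists2 u', u = rcons u' b & subseq u' v.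
Proof.
case/lastP: u => [|u a]; first by left; exact: sub0seq.
by rewrite subseq_rcons2; case: eqP => [-> ?|_ ?]; [right; exists u | left].
Qed.

Lemma subseq_insert u w :
  subseq u w -> size u < size w ->
  exists x a y, u = x ++ y /\ subseq (x ++ a :: y) w.
Proof.
elim: w u => [|b w IH] [|c u] //=.
  by move=> _ _; exists [::], b, [::]; rewrite /= eqxx sub0seq.
case: eqP => [->|_] sub_uw lt_uw; last first.
  by exists [::], b, (c :: u); rewrite /= eqxx.
have [x [a [y [-> sub_w]]]] := IH u sub_uw lt_uw.
by exists (b :: x), a, y; rewrite /= eqxx.
Qed.

(* The letter [b] is the first one of [v] that a leftmost embedding of [v] does
   not place inside [x]; doubling it forces the rest of [v] to the right of
   the deleted letter. *)
Lemma subseq_delete_doubled x a y v :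
  v != [::] ->
  exists v1 b v2, v = v1 ++ b :: v2 /\
    (subseq (v1 ++ b :: b :: v2) (x ++ a :: y) -> subseq v (x ++ y)).
Proof.
elim: x v => [|c x IH] [|d v] // _.
  exists [::], d, v; split=> //=; case: eqP => // _.
  exact: subseq_trans (subseq_cons _ _).
have [eq_dc|ne_dc] := eqVneq d c; last first.
  have [v1 [b [v2 [def_v sub_v]]]] := IH (d :: v) isT.
  exists v1, b, v2; split=> //=; rewrite (negbTE ne_dc).
  by case: v1 def_v sub_v => [|e v1] /= [<- _]; rewrite (negbTE ne_dc); apply.
case: v => [|e v]; first by exists [::], d, [::]; rewrite /= eq_dc eqxx sub0seq.
have [v1 [b [v2 [-> sub_v]]]] := IH (e :: v) isT.
by exists (d :: v1), b, v2; rewrite /= eq_dc eqxx.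
Qed.

Definition avoids L u : Prop :=
  exists2 v, L v & ~~ subseq v u.

Definition avoidance_cost L w c : Prop :=
  (exists2 u, subseq u w /\ size u + c = size w & avoids L u) /\
  (forall u, subseq u w -> avoids L u -> c + size u <= size w).

(* The code 0 stands for infinity, which agrees with the zero-initialised
   memory of the machine. *)
Definition avoidance_bound L w d : Prop :=
  if d is c.+1 then avoidance_cost L w c
  else forall u, subseq u w -> ~ avoids L u.

Definition ending L a v : Prop :=
  exists2 v', L v' & v = rcons v' a.

Lemma avoids_ending L a u : avoids L u -> avoids (ending L a) u.
Proof.
case=> v Lv not_sub; exists (rcons v a); first by exists v.
by apply: contra not_sub; exact: subseq_trans (subseq_rcons v a).
Qed.

Lemma avoids_ending_rcons L a b u :
  avoids (ending L a) (rcons u b) <->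
  if a == b then avoids L u else avoids (ending L a) u.
Proof.
split; last first.
  case: ifP => eq_ab; first case=> v Lv not_sub.
    by exists (rcons v a); [exists v | rewrite subseq_rcons2 eq_ab].
  case=> _ [v Lv ->] not_sub.
  by exists (rcons v a); [exists v | rewrite subseq_rcons2 eq_ab].
case=> _ [v Lv ->]; rewrite subseq_rcons2; case: ifP => _ not_sub.
  by exists v.
by exists (rcons v a); first exists v.
Qed.

Lemma avoidance_cost_ending_nil L a v :
  L v -> avoidance_cost (ending L a) [::] 0.
Proof.
move=> Lv; split=> [|u]; last by rewrite subseq0 => /eqP ->.
exists [::] => //; exists (rcons v a); first by exists v.
by rewrite subseq0 -size_eq0 size_rcons.
Qed.

Lemma avoidance_cost_ending_neq L a b w c : a != b ->
  avoidance_cost (ending L a) w c -> avoidance_cost (ending L a) (rcons w b) c.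
Proof.
move=> /negbTE ne_ab [[u [sub_u sz_u] av_u] min_c]; split.
  exists (rcons u b).
    by rewrite subseq_rcons2 eqxx !size_rcons addSn sz_u.
  by apply/avoids_ending_rcons; rewrite ne_ab.
move=> u' /subseq_rcons_inv [sub_u' /(min_c _ sub_u')|[u'' -> sub_u'']].
  by rewrite size_rcons; exact: leqW.
move=> /avoids_ending_rcons; rewrite ne_ab !size_rcons addnS ltnS.
exact: min_c.
Qed.

Lemma avoidance_cost_ending_le L a w c d :
  avoidance_cost (ending L a) w c -> avoidance_cost L w d -> c <= d.
Proof.
move=> [_ min_c] [[u [sub_u sz_u] av_u] _].
by have := min_c _ sub_u (avoids_ending a av_u); lia.
Qed.

Lemma avoidance_cost_ending_eq L a w c d :
  avoidance_cost (ending L a) w c -> avoidance_bound L w d ->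
  avoidance_cost (ending L a) (rcons w a) (if c.+1 == d then c else c.+1).
Proof.
move=> [cost_c min_c] bound_d; split.
  case: eqP => [eq_d|_]; last first.
    have [u [sub_u sz_u] av_u] := cost_c.
    exists u => //; rewrite size_rcons addnS sz_u; split=> //.
    exact: subseq_trans sub_u (subseq_rcons _ _).
  move: bound_d; rewrite -eq_d => -[[u' [sub_u' sz_u'] av_u'] _].
  exists (rcons u' a).
    by rewrite subseq_rcons2 eqxx !size_rcons addSn sz_u'.
  by apply/avoids_ending_rcons; rewrite eqxx.
move=> u' /subseq_rcons_inv [sub_u' /(min_c _ sub_u')|[u'' -> sub_u'']].
  by rewrite size_rcons; case: ifP => _; lia.
move=> /avoids_ending_rcons; rewrite eqxx !size_rcons => av_u''.
case: d bound_d => [/(_ _ sub_u'') //|d cost_d].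
have le_cd := avoidance_cost_ending_le (conj cost_c min_c) cost_d.
have := cost_d.2 _ sub_u'' av_u''.
by case: eqP => [[<-]|]; lia.
Qed.

Fixpoint words S t v : Prop :=
  if t is t'.+1 then exists2 a, a \in S & ending (words S t') a v
  else v = [::].

Lemma wordsP S t v : words S t v <-> size v = t /\ {subset v <= S}.
Proof.
elim: t v => [|t IH] v /=.
  by split=> [-> //|[/size0nil]].
split=> [[a aS [v' /IH [sz_v sub_v] ->]]|].
  rewrite size_rcons sz_v; split=> // b.
  by rewrite mem_rcons inE => /predU1P [->|/sub_v].
case/lastP: v => [[] //|v a]; rewrite size_rcons => -[[sz_v] sub_v].
exists a; first by apply: sub_v; rewrite mem_rcons mem_head.
exists v => //; apply/IH; split=> // b b_v.
by apply: sub_v; rewrite mem_rcons inE b_v orbT.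
Qed.

Lemma words_inhabited S t : S != [::] -> exists v, words S t v.
Proof.
move=> S_neq0; have [a aS] : exists a, a \in S.
  by case: (S) S_neq0 => // a ? _; exists a; exact: mem_head.
exists (nseq t a); apply/wordsP; rewrite size_nseq; split=> // b.
by rewrite mem_nseq => /andP [_ /eqP ->].
Qed.

End Avoidance.

Lemma deletions_cons m a w u :
  deletions m w u -> deletions m (a :: w) (a :: u).
Proof.
elim=> {m w u} [u|m x b y u _ IH]; first exact: Deletions0.
exact: (@DeletionsS m (a :: x) b y).
Qed.

Lemma deletionsP m w u :
  deletions m w u <-> subseq u w /\ size u + m = size w.
Proof.
split=> [|[sub_u sz_u]].
  elim=> {m w u} [u|m x a y u _ [sub_u sz_u]]; first by rewrite addn0.
  rewrite addnS sz_u !size_cat addnS; split=> //.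
  exact/(subseq_trans sub_u)/cat_subseq/subseq_cons.
elim: w u m sub_u sz_u => [|a w IH] [|b u] m //=.
- by case: m => // _ _; exact: Deletions0.
- case: m => // m _ [sz_w]; apply: (@DeletionsS m [::] a).
  by apply: IH => //; exact: sub0seq.
case: eqP => [->|_] sub_u [sz_w]; first exact/deletions_cons/IH.
case: m sz_w => [|m] sz_w; first by have := size_subseq sub_u; rewrite /=; lia.
by apply: (@DeletionsS m [::] a); apply: IH => //=; lia.
Qed.

Section Universality.

Variable S : seq nat.
Implicit Types (u v w x y : seq nat) (a j k m : nat).

Lemma universalP k u : universal S k u <-> ~ avoids (words S k) u.
Proof.
split=> [univ [v /wordsP [sz_v sub_v]]|not_av v sz_v sub_v].
  by rewrite univ.
by apply/negPn/negP => not_sub; apply: not_av; exists v => //; apply/wordsP.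
Qed.

Lemma universal_delete k x a y :
  universal S k.+1 (x ++ a :: y) -> universal S k (x ++ y).
Proof.
move=> univ v sz_v sub_v; have [->|v_n0] := eqVneq v [::]; first exact: sub0seq.
have [v1 [b [v2 [def_v]]]] := subseq_delete_doubled x a y v_n0; apply.
apply: univ; first by rewrite -sz_v def_v !size_cat /= !addnS.
move=> z z_in; apply: sub_v; move: z_in; rewrite def_v !mem_cat !inE.
by case: (z == b).
Qed.

Hypothesis S_neq0 : S != [::].

Lemma universal_leq j k u : j <= k -> universal S k u -> universal S j u.
Proof.
move=> le_jk univ v sz_v sub_v.
have [v' /wordsP [sz_v' sub_v']] := words_inhabited (k - j) S_neq0.
apply: subseq_trans (prefix_subseq v v') _; apply: univ.
  by rewrite size_cat sz_v sz_v' subnKC.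
by move=> a; rewrite mem_cat => /orP [/sub_v|/sub_v'].
Qed.

Lemma min_deletions_avoidance_cost w k m :
  universal S k w -> avoidance_cost (words S k.+1) w m -> min_deletions S w k m.
Proof.
move=> univ_w [[u [sub_u sz_u] av_u] min_m].
have univ_below u' m' : subseq u' w -> size u' + m' = size w -> m' < m ->
    universal S k.+1 u'.
  move=> sub_u' sz_u' lt_m'; apply/universalP => /(min_m _ sub_u').
  by rewrite -sz_u' addnC leq_add2l leqNgt lt_m'.
split=> [|m' u' /deletionsP [sub_u' sz_u'] [_ max_k]]; last first.
  rewrite leqNgt; apply/negP => /(univ_below _ _ sub_u' sz_u') /max_k.
  by rewrite ltnn.
exists u; first exact/deletionsP.
split=> [|j univ_j]; last first.
  rewrite leqNgt; apply/negP => lt_kj.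
  by have /universalP := universal_leq lt_kj univ_j; apply.
case: m sz_u {av_u min_m} univ_below => [|m] sz_u univ_below.
  suff -> : u = w by [].
  by apply/eqP; rewrite -(size_subseq_leqif sub_u) -sz_u addn0.
have [|x [a [y [def_u sub_xay]]]] := subseq_insert sub_u; first by lia.
rewrite def_u; apply/universal_delete/(univ_below _ m sub_xay) => //.
by move: sz_u; rewrite def_u !size_cat /=; lia.
Qed.

End Universality.

(** * The recurrence *)

Section MinOver.

Variable T : eqType.
Implicit Types (S w : seq T) (f g : T -> nat) (a : T) (m t : nat).

(* The maximum is a neutral initial value when [S] is nonempty. *)
Definition min_over S f : nat :=
  \big[minn/(\max_(a <- S) f a)]_(a <- S) f a.

Lemma leq_min_over S f m :
  S != [::] -> (m <= min_over S f) = all (fun a => m <= f a) S.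
Proof.
have leq_bigmin d :
    (m <= \big[minn/d]_(a <- S) f a) = (m <= d) && all (fun a => m <= f a) S.
  elim: S => [|a S IH]; first by rewrite big_nil andbT.
  by rewrite big_cons leq_min IH andbCA.
case: S leq_bigmin => // a S leq_bigmin _; rewrite leq_bigmin andb_idl //.
by move=> /= /andP [le_m _]; apply: leq_trans le_m _; rewrite big_cons leq_maxl.
Qed.

Lemma min_over_le S f a : a \in S -> min_over S f <= f a.
Proof.
move=> aS; have S_neq0 : S != [::] by case: (S) aS.
by have := leqnn (min_over S f); rewrite leq_min_over // => /allP; apply.
Qed.

Lemma min_over_mem S f : S != [::] -> exists2 a, a \in S & f a = min_over S f.
Proof.
move=> S_neq0; have := ltnn (min_over S f).
rewrite leq_min_over // => /negbT /allPn [a aS]; rewrite -leqNgt => le_fa.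
by exists a => //; apply/eqP; rewrite eqn_leq le_fa min_over_le.
Qed.

Lemma min_over_incr S f g a : a \in S ->
  g a = (f a).+1 -> {in S, forall b, b != a -> g b = f b} ->
  min_over S g = if all (fun b => f a < g b) S then g a else min_over S f.
Proof.
move=> aS ga gE; have S_neq0 : S != [::] by case: (S) aS.
apply/eqP; rewrite eqn_leq; case: ifP => [lt_g|/negbT /allPn [b bS]].
  by rewrite min_over_le // leq_min_over // ga.
rewrite -leqNgt => le_gb; apply/andP; split; last first.
  rewrite leq_min_over //; apply/allP => x xS.
  have := min_over_le f xS.
  by case: (eqVneq x a) => [->|ne_xa]; rewrite ?ga ?gE // => /leqW.
have [x xS <-] := min_over_mem f S_neq0.
have [->|ne_xa] := eqVneq x a; last by rewrite -gE ?min_over_le.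
exact: leq_trans (min_over_le g bS) le_gb.
Qed.

Lemma count_leq_incr S f g a d : uniq S -> a \in S ->
  g a = (f a).+1 -> {in S, forall b, b != a -> g b = f b} ->
  count (fun b => d <= g b) S = count (fun b => d <= f b) S + (d == g a).
Proof.
move=> uniq_S aS ga gE; have /permP perm_S := perm_to_rem aS.
rewrite !perm_S /= ga (eq_in_count (a2 := fun b => d <= f b)) => [|b].
  by lia.
by rewrite mem_rem_uniq // inE => /andP [ne_ba bS]; rewrite gE.
Qed.

Lemma avoidance_cost_words S t w f : S != [::] ->
  {in S, forall a, avoidance_cost (ending (words S t) a) w (f a)} ->
  avoidance_cost (words S t.+1) w (min_over S f).
Proof.
move=> S_neq0 cost_f; split=> [|u sub_u [v [a aS end_v] not_sub]]; last first.
  have [_ min_fa] := cost_f a aS.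
  apply: leq_trans (min_fa u sub_u _); last by exists v.
  by rewrite leq_add2r min_over_le.
have [a aS <-] := min_over_mem f S_neq0.
have [[u sub_u [v end_v not_sub]] _] := cost_f a aS.
by exists u => //; exists v => //; exists a.
Qed.

End MinOver.

Section Recurrence.

Variables (S w : seq nat).
Implicit Types (D : nat -> nat) (a p t : nat).

Fixpoint ending_cost D p : nat -> nat :=
  if p is q.+1 then
    let f := ending_cost D q in
    let c := f (nth 0 w q) in
    if c.+1 == D q then f else upd f (nth 0 w q) c.+1
  else fun=> 0.

Fixpoint prefix_bound t p : nat :=
  if t is t'.+1 then (min_over S (ending_cost (prefix_bound t') p)).+1 else 0.

Lemma ending_cost_le D p a : ending_cost D p a <= p.
Proof.
elim: p a => //= p IH a; case: ifP => _; first exact: leqW.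
by rewrite /upd; case: ifP => _; rewrite ?ltnS // leqW.
Qed.

Lemma ending_cost_letter D p (c := ending_cost D p (nth 0 w p)) :
  ending_cost D p.+1 (nth 0 w p) = if c.+1 == D p then c else c.+1.
Proof. by rewrite /=; case: ifP => // _; rewrite /upd eqxx. Qed.

Lemma ending_cost_other D p a :
  a != nth 0 w p -> ending_cost D p.+1 a = ending_cost D p a.
Proof. by move=> /negbTE ne_a /=; case: ifP => // _; rewrite /upd ne_a. Qed.

Lemma ending_costP L D v p a : L v ->
  (forall q, q < p -> avoidance_bound L (take q w) (D q)) -> p <= size w ->
  avoidance_cost (ending L a) (take p w) (ending_cost D p a).
Proof.
move=> Lv; elim: p => [|p IH] bound_D lt_p.
  by rewrite take0; exact: avoidance_cost_ending_nil Lv.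
have {}IH := IH (fun q lt_q => bound_D q (leqW lt_q)) (ltnW lt_p).
rewrite (take_nth 0) //; have [def_a|ne_a] := eqVneq a (nth 0 w p).
  rewrite def_a ending_cost_letter -def_a.
  exact: avoidance_cost_ending_eq IH (bound_D p _).
by rewrite ending_cost_other //; exact: avoidance_cost_ending_neq IH.
Qed.

Hypothesis S_neq0 : S != [::].

Lemma prefix_boundP t p :
  p <= size w -> avoidance_bound (words S t) (take p w) (prefix_bound t p).
Proof.
elim: t p => [|t IH] p le_p /=; first by move=> u _ [v ->]; rewrite sub0seq.
apply: avoidance_cost_words => // a _.
have [v words_v] := words_inhabited t S_neq0.
by apply: ending_costP words_v _ _ => // q lt_q; apply: IH; lia.
Qed.

Lemma prefix_bound_le t p : prefix_bound t p <= p.+1.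
Proof.
case: t => [|t] //=.
have [a _ <-] := min_over_mem (ending_cost (prefix_bound t) p) S_neq0.
exact: ending_cost_le.
Qed.

Lemma min_deletions_prefix_bound k :
  universal S k w -> min_deletions S w k (prefix_bound k.+1 (size w)).-1.
Proof.
move=> univ_w; apply: min_deletions_avoidance_cost => //.
by have := prefix_boundP k.+1 (leqnn (size w)); rewrite take_size.
Qed.

Section Increment.

Variables (D : nat -> nat) (p : nat).
Let c := ending_cost D p (nth 0 w p).
Hypotheses (letterS : nth 0 w p \in S) (c_neq : c.+1 != D p).

Lemma ending_cost_incr : ending_cost D p.+1 (nth 0 w p) = c.+1.
Proof. by rewrite ending_cost_letter ifN. Qed.

Lemma min_ending_cost_incr :
  min_over S (ending_cost D p.+1) =
  if all (fun a => c < ending_cost D p.+1 a) S then c.+1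
  else min_over S (ending_cost D p).
Proof.
rewrite (min_over_incr letterS ending_cost_incr) ?ending_cost_incr //.
by move=> a _; exact: ending_cost_other.
Qed.

Lemma count_ending_cost_incr d : uniq S ->
  count (fun a => d <= ending_cost D p.+1 a) S =
  count (fun a => d <= ending_cost D p a) S + (d == c.+1).
Proof.
move=> uniq_S; rewrite (count_leq_incr _ uniq_S letterS ending_cost_incr).
  by rewrite ending_cost_incr.
by move=> a _; exact: ending_cost_other.
Qed.

End Increment.

Lemma ending_cost_stay D p : (ending_cost D p (nth 0 w p)).+1 = D p ->
  ending_cost D p.+1 = ending_cost D p.
Proof. by move=> eq_c; rewrite /= eq_c eqxx. Qed.

Lemma prefix_bound_stay t p :
  (ending_cost (prefix_bound t) p (nth 0 w p)).+1 = prefix_bound t p ->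
  prefix_bound t.+1 p.+1 = prefix_bound t.+1 p.
Proof. by move=> eq_c; rewrite /= eq_c eqxx. Qed.

End Recurrence.

(** * Structured programs *)

Definition exec b P T c (Q : config -> Prop) : Prop :=
  exists2 t, t <= T & Q (iter t (step b P) c).

Lemma exec_done b P T c (Q : config -> Prop) : Q c -> exec b P T c Q.
Proof. by exists 0. Qed.

Lemma exec_step b P T c Q :
  exec b P T (step b P c) Q -> exec b P T.+1 c Q.
Proof. by case=> t le_t Qt; exists t.+1; rewrite ?iterSr. Qed.

Lemma exec_bind b P T1 T2 c Q1 Q2 :
  exec b P T1 c Q1 -> (forall c', Q1 c' -> exec b P T2 c' Q2) ->
  exec b P (T1 + T2) c Q2.
Proof.
move=> [t1 le1 /[swap] /[apply] -[t2 le2 Q2t]].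
by exists (t2 + t1); rewrite ?iterD // addnC leq_add.
Qed.

Lemma exec_weaken b P T T' c Q : T <= T' -> exec b P T c Q -> exec b P T' c Q.
Proof. by move=> le_T [t le_t Qt]; exists t => //; exact: leq_trans le_T. Qed.

(* [Unless o s t body] runs [body] if the comparison [s o t] fails;
   [Until s t body] repeats [body] until [s] and [t] are equal. *)
Inductive cmd :=
| Do (i : instr)
| Unless (o : binop) (s t : nat) (body : seq cmd)
| Until (s t : nat) (body : seq cmd).

Local Notation flag := 1 (only parsing).

Definition compile_block (comp : cmd -> nat -> seq instr) :=
  fix block (cs : seq cmd) (p : nat) : seq instr :=
    if cs is c :: cs' then
      let code := comp c p in code ++ block cs' (p + size code)
    else [::].

Fixpoint compile_cmd (c : cmd) (p : nat) : seq instr :=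
  match c with
  | Do i => [:: i]
  | Unless o s t body =>
      let code := compile_block compile_cmd body p.+2 in
      [:: Op o flag s t, JumpIf flag (p.+2 + size code) & code]
  | Until s t body =>
      let code := compile_block compile_cmd body p.+2 in
      [:: Op Eq flag s t, JumpIf flag (p.+2 + size code).+1
        & rcons code (Jump p)]
  end.

Definition compile : seq cmd -> nat -> seq instr := compile_block compile_cmd.

Definition placed (P : program) p (code : seq instr) : Prop :=
  forall i, i < size code -> nth Halt P (p + i) = nth Halt code i.

Lemma placed_cat P p code1 code2 : placed P p (code1 ++ code2) ->
  placed P p code1 /\ placed P (p + size code1) code2.
Proof.
move=> at_p; split=> i lt_i.
  by rewrite at_p ?nth_cat ?lt_i // size_cat ltn_addr.
by rewrite -addnA at_p ?nth_cat ?size_cat ?ltn_add2l // ltnNge leq_addr addKn.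
Qed.

Lemma placed_cons P p i code : placed P p (i :: code) ->
  nth Halt P p = i /\ placed P p.+1 code.
Proof.
rewrite -cat1s => /placed_cat [at_p at_code].
by split; [rewrite -[p]addn0 at_p | rewrite -addn1].
Qed.

Definition assertion := (nat -> nat) -> (nat -> nat) -> Prop.

Definition runs b cs T r m (Q : assertion) : Prop :=
  forall P p, placed P p (compile cs p) ->
  exec b P T (Config p r m)
    (fun c => pc c = p + size (compile cs p) /\ Q (reg c) (Defs.mem c)).

Section Runs.

Variables (b : nat) (cs : seq cmd) (T : nat) (r m : nat -> nat).
Variable Q : assertion.

Lemma runs_nil : Q r m -> runs b [::] T r m Q.
Proof. by move=> Qrm P p _; apply: exec_done; rewrite addn0. Qed.

Lemma runs_conseq T' (Q' : assertion) :
  T' <= T -> (forall r' m', Q' r' m' -> Q r' m') ->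
  runs b cs T' r m Q' -> runs b cs T r m Q.
Proof.
move=> le_T Q'Q run P p at_p; have [t le_t [pc_t Q't]] := run P p at_p.
by exists t; [exact: leq_trans le_T | split=> //; exact: Q'Q].
Qed.

Lemma runs_weaken T' : T' <= T -> runs b cs T' r m Q -> runs b cs T r m Q.
Proof. by move=> le_T; exact: runs_conseq. Qed.

Lemma runs_do i r' m' :
  (forall P p, nth Halt P p = i ->
     step b P (Config p r m) = Config p.+1 r' m') ->
  runs b cs T r' m' Q -> runs b (Do i :: cs) T.+1 r m Q.
Proof.
move=> step_i run P p /placed_cons [/step_i step_p at_cs]; apply: exec_step.
rewrite step_p /= addn1 addnS; move: at_cs; rewrite addn1.
exact: run.
Qed.

Lemma runs_const i x : x < 2 ^ b ->
  runs b cs T (upd r i x) m Q -> runs b (Do (Const i x) :: cs) T.+1 r m Q.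
Proof.
move=> lt_x; apply: runs_do => P p; rewrite /step /fetch => ->.
by rewrite modn_small.
Qed.

Lemma runs_read i s x y : r s = x -> m x = y ->
  runs b cs T (upd r i y) m Q -> runs b (Do (Read i s) :: cs) T.+1 r m Q.
Proof. by move=> <- <-; apply: runs_do => P p; rewrite /step /fetch => ->. Qed.

Lemma runs_write i s x y : r i = x -> r s = y ->
  runs b cs T r (upd m x y) Q -> runs b (Do (Write i s) :: cs) T.+1 r m Q.
Proof. by move=> <- <-; apply: runs_do => P p; rewrite /step /fetch => ->. Qed.

Lemma runs_add i s t x y : r s = x -> r t = y -> x + y < 2 ^ b ->
  runs b cs T (upd r i (x + y)) m Q ->
  runs b (Do (Op Add i s t) :: cs) T.+1 r m Q.
Proof.
move=> <- <- lt_xy; apply: runs_do => P p.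
by rewrite /step /fetch => ->; rewrite modn_small.
Qed.

Lemma runs_sub i s t x y : r s = x -> r t = y -> y <= x < 2 ^ b ->
  runs b cs T (upd r i (x - y)) m Q ->
  runs b (Do (Op Defs.Sub i s t) :: cs) T.+1 r m Q.
Proof.
move=> <- <- /andP [le_yx lt_x]; apply: runs_do => P p.
rewrite /step /fetch => -> /=.
have le_y := leq_trans le_yx (ltnW lt_x).
rewrite addnBA // addnC -addnBA // modnDl modn_small //.
exact: leq_ltn_trans (leq_subr _ _) lt_x.
Qed.

End Runs.

Lemma bool_lt_word b (x : bool) : 0 < b -> x < 2 ^ b.
Proof. by move=> b_gt0; apply: leq_ltn_trans (ltn_expl b _); case: x. Qed.

Lemma exec_test b P T p r m o s t (x : bool) l R : 0 < b ->
  nth Halt P p = Op o flag s t -> nth Halt P p.+1 = JumpIf flag l ->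
  eval_op b o (r s) (r t) = x ->
  exec b P T (Config (if x then l else p.+2) (upd r flag x) m) R ->
  exec b P T.+2 (Config p r m) R.
Proof.
move=> b_gt0 at_p at_p1 eval_x run; apply/exec_step/exec_step.
rewrite /step /fetch /= at_p /= at_p1 eval_x modn_small ?bool_lt_word //.
by rewrite /upd /= eqb0 negbK.
Qed.

Section Branching.

Variables (b : nat) (cs : seq cmd) (T : nat).
Variable Q : assertion.
Hypothesis b_gt0 : 0 < b.

Lemma runs_unless o s t body (x : bool) T' r m :
  eval_op b o (r s) (r t) = x ->
  (x -> runs b cs T (upd r flag 1) m Q) ->
  (~~ x ->
     runs b body T' (upd r flag 0) m (fun r' m' => runs b cs T r' m' Q)) ->
  runs b (Unless o s t body :: cs) (T' + T).+2 r m Q.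
Proof.
move=> eval_x run_true run_false P p.
set code := compile body p.+2; set q := p.+2 + size code.
have -> : compile (Unless o s t body :: cs) p =
    [:: Op o flag s t, JumpIf flag q & code ++ compile cs q].
  by rewrite /= /q !addnS -!addSn.
rewrite [p + _](_ : _ = q + size (compile cs q));
  last by rewrite /= size_cat; lia.
move=> /placed_cons [at_p /placed_cons [at_p1 /placed_cat [at_code at_cs]]].
apply: exec_test b_gt0 at_p at_p1 eval_x _.
case: x run_true run_false => [/(_ isT) run_cs _|_ /(_ isT) run_body].
  by apply: exec_weaken (leq_addl _ _) _; exact: run_cs.
apply: exec_bind (run_body _ _ at_code) _ => -[p' r' m'] /= [-> run_cs].
exact: run_cs.
Qed.

Lemma runs_until (Inv : nat -> assertion) s t body T' d r m :
  (forall d r m, Inv d r m -> (r s == r t) = (d == 0)) ->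
  (forall d r m, Inv d.+1 r m -> runs b body T' (upd r flag 0) m (Inv d)) ->
  (forall r m, Inv 0 r m -> runs b cs T (upd r flag 1) m Q) ->
  Inv d r m -> runs b (Until s t body :: cs) (d * T'.+3 + T.+2) r m Q.
Proof.
move=> test_Inv run_body run_cs Inv_d P p.
set code := compile body p.+2; set q := (p.+2 + size code).+1.
have -> : compile (Until s t body :: cs) p =
    [:: Op Eq flag s t, JumpIf flag q & code ++ Jump p :: compile cs q].
  by rewrite /= size_rcons cat_rcons /q !addnS -!addSn.
rewrite [p + _](_ : _ = q + size (compile cs q));
  last by rewrite /= size_cat /=; lia.
move=> /placed_cons [at_p /placed_cons [at_p1 /placed_cat [at_code]]].
move=> /placed_cons [at_jump at_cs].
elim: d r m Inv_d => [|d IH] r m Inv_d;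
    have eval_d := congr1 nat_of_bool (test_Inv _ _ _ Inv_d).
  by apply: exec_test b_gt0 at_p at_p1 eval_d _; exact: run_cs.
rewrite mulSn -addnA !addSn; apply: exec_test b_gt0 at_p at_p1 eval_d _.
rewrite -addnS; apply: exec_bind (run_body _ _ _ Inv_d _ _ at_code) _.
move=> -[p' r' m'] /= [-> Inv_d']; apply: exec_step.
by rewrite /step /fetch /= at_jump; exact: IH.
Qed.

End Branching.

Lemma runs_computes b cs T input output :
  runs b cs T (fun=> 0) (nth 0 input) (fun r _ => r 0 = output) ->
  computes_within b (compile cs 0) input T output.
Proof.
move=> /(_ (compile cs 0) 0) [//|t le_t [pc_t out_t]].
by exists t; split=> //; rewrite /halted /fetch nth_default // pc_t.
Qed.

Definition table (m : nat -> nat) base (A : seq nat) (f : nat -> nat) : Prop :=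
  {in A, forall i, m (base + i) = f i}.

Lemma table_upd m base A f g i x :
  table m base A f -> g i = x -> {in A, forall j, j != i -> g j = f j} ->
  table (upd m (base + i) x) base A g.
Proof.
move=> tab_f gi gE j Aj; rewrite /upd eqn_add2l.
by case: eqP => [->|/eqP ne_ji]; rewrite ?gi // gE // tab_f.
Qed.

Lemma table_upd_disjoint m base A f x y :
  table m base A f -> {in A, forall i, base + i != x} ->
  table (upd m x y) base A f.
Proof. by move=> tab_f disj i Ai; rewrite /upd (negbTE (disj i Ai)) tab_f. Qed.

Lemma eq_table m base A f g :
  table m base A f -> {in A, f =1 g} -> table m base A g.
Proof. by move=> tab_f eq_fg i Ai; rewrite tab_f ?eq_fg. Qed.

(** * The program *)

(* With [n] the length of [w], the word is stored from address 3 on, the bound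
   of position [p] at [3 + n + p], the cost of the letter [a] at [3 + 2n + a],
   and the number of letters of cost at least [d] at [3 + 3n + d]. *)
Local Notation r_answer := 0 (only parsing).
Local Notation r_zero := 2 (only parsing).
Local Notation r_one := 3 (only parsing).
Local Notation r_length := 4 (only parsing).
Local Notation r_letters := 5 (only parsing).
Local Notation r_rounds := 6 (only parsing).
Local Notation r_word := 7 (only parsing).
Local Notation r_bounds := 8 (only parsing).
Local Notation r_costs := 9 (only parsing).
Local Notation r_counts := 10 (only parsing).
Local Notation r_end := 11 (only parsing).
Local Notation r_round := 12 (only parsing).
Local Notation r_clear := 13 (only parsing).
Local Notation r_pos := 14 (only parsing).
Local Notation r_addr := 15 (only parsing).
Local Notation r_bound := 16 (only parsing).
Local Notation r_cost_addr := 17 (only parsing).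
Local Notation r_cost := 18 (only parsing).
Local Notation r_count := 19 (only parsing).

Definition setup : seq cmd := [::
  Do (Const r_one 1);
  Do (Read r_length r_zero);
  Do (Read r_letters r_one);
  Do (Const r_rounds 2);
  Do (Read r_rounds r_rounds);
  Do (Op Add r_rounds r_rounds r_one);
  Do (Const r_word 3);
  Do (Op Add r_bounds r_word r_length);
  Do (Op Add r_costs r_bounds r_length);
  Do (Op Add r_counts r_costs r_length);
  Do (Op Add r_end r_counts r_length);
  Do (Op Add r_end r_end r_one)].

Definition clear_loop : cmd :=
  Until r_clear r_end [::
    Do (Write r_clear r_zero);
    Do (Op Add r_clear r_clear r_one)].

Definition raise_cost : seq cmd := [::
  Do (Write r_cost_addr r_cost);
  Do (Op Add r_addr r_counts r_cost);
  Do (Read r_count r_addr);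
  Do (Op Add r_count r_count r_one);
  Do (Write r_addr r_count);
  Unless Lt r_count r_letters [::
    Do (Op Add r_answer r_cost r_one)]].

Definition scan_letter : seq cmd := [::
  Do (Op Add r_addr r_word r_pos);
  Do (Read r_cost_addr r_addr);
  Do (Op Add r_cost_addr r_costs r_cost_addr);
  Do (Read r_cost r_cost_addr);
  Do (Op Add r_cost r_cost r_one);
  Do (Op Add r_addr r_bounds r_pos);
  Do (Read r_bound r_addr);
  Do (Write r_addr r_answer);
  Do (Op Add r_pos r_pos r_one);
  Unless Eq r_cost r_bound raise_cost].

Definition play_round : seq cmd := [::
  Do (Op Add r_clear r_costs r_one);
  clear_loop;
  Do (Const r_pos 0);
  Do (Const r_answer 1);
  Until r_pos r_length scan_letter;
  Do (Op Add r_round r_round r_one)].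

Definition deletion_code : seq cmd := setup ++ [::
  Until r_round r_rounds play_round;
  Do (Op Defs.Sub r_answer r_answer r_one)].

Ltac register_value := rewrite /upd /=; first [eassumption | reflexivity].
Ltac in_word := rewrite ?/upd /=; lia.
Ltac run_const := eapply runs_const; [in_word | ].
Ltac run_add := eapply runs_add; [register_value | register_value | in_word | ].
Ltac run_sub := eapply runs_sub; [register_value | register_value | in_word | ].
Ltac run_read := eapply runs_read; [register_value | | ].
Ltac run_write := eapply runs_write; [register_value | register_value | ].

Section Correctness.

Variables (b sigma k : nat) (w : seq nat).

Local Notation n := (size w).
Local Notation Sigma := (iota 1 sigma).
Local Notation B := (prefix_bound Sigma w).
Local Notation cost t := (ending_cost w (B t)).

Hypothesis word_fits : 4 * n + 4 < 2 ^ b.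
Hypothesis sigma_range : 0 < sigma <= n.
Hypothesis w_letters : {subset w <= Sigma}.

Let b_gt0 : 0 < b.
Proof. by case: b word_fits => //; lia. Qed.

Let Sigma_neq0 : Sigma != [::].
Proof. by rewrite -size_eq0 size_iota; lia. Qed.

Lemma letter_mem p : p < n -> nth 0 w p \in Sigma.
Proof. by move=> lt_p; exact/w_letters/mem_nth. Qed.

Lemma letter_range p : p < n -> 0 < nth 0 w p <= n.
Proof. by move=> /letter_mem; rewrite mem_iota; lia. Qed.

Lemma cost_lt t p a : p < n -> cost t p a < n.
Proof. exact/leq_ltn_trans/ending_cost_le. Qed.

Record layout t (r : nat -> nat) : Prop := {
  layout_zero : r r_zero = 0;
  layout_one : r r_one = 1;
  layout_length : r r_length = n;
  layout_letters : r r_letters = sigma;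
  layout_rounds : r r_rounds = k + 1;
  layout_word : r r_word = 3;
  layout_bounds : r r_bounds = 3 + n;
  layout_costs : r r_costs = 3 + n + n;
  layout_counts : r r_counts = 3 + n + n + n;
  layout_end : r r_end = 3 + n + n + n + n + 1;
  layout_round : r r_round = t }.

Lemma layout_flag t r x : layout t r -> layout t (upd r flag x).
Proof. by case; split. Qed.

Definition played t : assertion := fun r m =>
  [/\ layout t r, r r_answer = B t n,
      table m 3 (iota 0 n) (nth 0 w) & table m (3 + n) (iota 0 n) (B t)].

(* Round [t] has updated the bounds of the positions below [q] and the costs and
   counts up to position [p]. *)
Record scan_tables t q p m : Prop := {
  scan_word : table m 3 (iota 0 n) (nth 0 w);
  scan_bounds :
    table m (3 + n) (iota 0 n) (fun i => B (if i < q then t.+1 else t) i);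
  scan_costs : table m (3 + n + n) Sigma (cost t p);
  scan_counts : table m (3 + n + n + n) (iota 1 n)
    (fun d => count (fun a => d <= cost t p a) Sigma) }.

Definition scanned t p : assertion := fun r m =>
  [/\ layout t r, r r_pos = p, r r_answer = B t.+1 p & scan_tables t p p m].

Lemma scan_write_bound t p m : p < n -> scan_tables t p p m ->
  scan_tables t p.+1 p (upd m (3 + n + p) (B t.+1 p)).
Proof.
move=> lt_p [word bounds costs counts]; split.
- by apply: table_upd_disjoint word _ => i; rewrite mem_iota; lia.
- apply: table_upd bounds _ _ => [|i _ ne_ip]; first by rewrite ltnSn.
  by rewrite ltnS leq_eqVlt (negbTE ne_ip).
- by apply: table_upd_disjoint costs _ => i; rewrite mem_iota; lia.
- by apply: table_upd_disjoint counts _ => i; rewrite mem_iota; lia.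
Qed.

Lemma scan_stay t q p m : (cost t p (nth 0 w p)).+1 = B t p ->
  scan_tables t q p m -> scan_tables t q p.+1 m.
Proof. by move=> stay [] *; split; rewrite ?(ending_cost_stay stay). Qed.

Lemma scan_incr t q p m (a := nth 0 w p) (c := cost t p a) :
  p < n -> c.+1 != B t p -> scan_tables t q p m ->
  scan_tables t q p.+1
    (upd (upd m (3 + n + n + a) c.+1) (3 + n + n + n + c.+1)
       (count (fun x => c < cost t p x) Sigma + 1)).
Proof.
move=> lt_p c_neq [word bounds costs counts].
have aS : a \in Sigma := letter_mem lt_p.
have a_range : 0 < a <= n := letter_range lt_p.
have c_lt : c < n := cost_lt t a lt_p.
split.
- by do 2! [apply: table_upd_disjoint; last by move=> i; rewrite mem_iota; lia].
- by do 2! [apply: table_upd_disjoint; last by move=> i; rewrite mem_iota; lia].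
- apply: table_upd_disjoint => [|i]; last by rewrite mem_iota; lia.
  apply: table_upd costs _ _; first exact: ending_cost_incr.
  by move=> x _; exact: ending_cost_other.
- apply: (table_upd (f := fun d => count (fun x => d <= cost t p x) Sigma)).
  + by apply: table_upd_disjoint counts _ => d; rewrite mem_iota; lia.
  + by rewrite count_ending_cost_incr ?iota_uniq ?eqxx.
  + move=> d _ /negbTE ne_d.
    by rewrite count_ending_cost_incr ?iota_uniq // ne_d addn0.
Qed.

Lemma prefix_bound_incr t p (c := cost t p (nth 0 w p)) :
  p < n -> c.+1 != B t p ->
  B t.+1 p.+1 =
  if count (fun a => c < cost t p a) Sigma + 1 < sigma then B t.+1 p else c.+2.
Proof.
move=> /letter_mem letter_in c_neq.
have := count_size (fun a => c < cost t p.+1 a) Sigma.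
rewrite [B t.+1 p.+1]/= min_ending_cost_incr // all_count size_iota.
by rewrite count_ending_cost_incr ?iota_uniq // eqxx -/c; case: ltngtP.
Qed.

Lemma runs_raise_cost t p r m (a := nth 0 w p) (c := cost t p a) :
  p < n -> c.+1 != B t p -> layout t r -> r r_pos = p.+1 ->
  r r_cost_addr = 3 + n + n + a -> r r_cost = c.+1 -> r r_answer = B t.+1 p ->
  scan_tables t p.+1 p m -> runs b raise_cost 8 r m (scanned t p.+1).
Proof.
move=> lt_p c_neq lay r_p r_addr_a r_c r_ans tables.
have c_lt : c < n := cost_lt t a lt_p.
have a_range : 0 < a <= n := letter_range lt_p.
set h := count (fun x => c < cost t p x) Sigma.
have h_le : h <= sigma by rewrite -[leqRHS](size_iota 1) count_size.
have tables' := scan_incr lt_p c_neq tables.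
have ans_incr := prefix_bound_incr lt_p c_neq.
case: (lay) => *; run_write; run_add; run_read.
  rewrite /upd ifF; last by lia.
  by apply: (scan_counts tables); rewrite mem_iota; lia.
run_add; run_write.
apply: (runs_unless b_gt0 (x := h + 1 < sigma) (T := 0) (T' := 1)).
- by rewrite /upd /= (layout_letters lay).
- by move=> lt_h; apply: runs_nil; split=> //; rewrite ans_incr lt_h.
- move=> /negbTE ge_h; run_add; apply/runs_nil/runs_nil; split=> //.
  by rewrite ans_incr ge_h /upd /= !addn1.
Qed.

Lemma runs_scan_letter t p r m : p < n -> scanned t p r m ->
  runs b scan_letter 19 r m (scanned t p.+1).
Proof.
move=> lt_p [lay r_p r_ans tables]; have [word bounds costs _] := tables.
have p_in : p \in iota 0 n by rewrite mem_iota.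
have a_in := letter_mem lt_p; have a_range := letter_range lt_p.
have c_lt := cost_lt t (nth 0 w p) lt_p.
have tables' := scan_write_bound lt_p tables.
case: (lay) => *; run_add; run_read; first exact: word.
run_add; run_read; first exact: costs.
run_add; run_add; run_read; first exact: bounds.
rewrite ltnn; run_write; run_add; rewrite !addn1.
set c := cost t p _ in c_lt *.
apply: (runs_unless b_gt0 (x := c.+1 == B t p) (T := 0) (T' := 8)).
- by [].
- move=> /eqP stay; apply: runs_nil; split=> //; last exact: scan_stay.
  by rewrite (prefix_bound_stay stay).
- move=> c_neq.
  apply: runs_conseq (runs_raise_cost lt_p c_neq _ _ _ _ _ tables') => // *.
  exact: runs_nil.
Qed.

Lemma runs_clear_loop cs T (Q : assertion) t r m :
  layout t r -> r r_clear = 3 + n + n + 1 ->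
  (forall r' m', layout t r' ->
     (forall x, m' x = if 3 + n + n < x <= 3 + n + n + n + n then 0 else m x) ->
     runs b cs T r' m' Q) ->
  runs b (clear_loop :: cs) ((n + n) * 5 + T.+2) r m Q.
Proof.
move=> lay at_start run_cs.
pose cleared d : assertion := fun r' m' =>
  [/\ layout t r', 3 + n + n < r' r_clear,
      r' r_clear + d = 3 + n + n + n + n + 1 &
      forall x, m' x = if 3 + n + n < x < r' r_clear then 0 else m x].
apply: (runs_until b_gt0 (Inv := cleared)).
- by move=> d r' m' [[]] *; lia.
- move=> d r' m' [lay' gt_start at_d m'E]; case: (lay') => *.
  run_write; run_add; apply: runs_nil.
  split=> //; rewrite /upd /=; [lia | lia | move=> x].
  by rewrite m'E; case: eqP => ?; repeat case: ifP; lia.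
- move=> r' m' [lay' _ at_end m'E]; apply: run_cs; first exact: layout_flag.
  by move=> x; rewrite m'E; repeat case: ifP; lia.
- by split=> // [||x]; rewrite at_start; [lia | lia | case: ifP; lia].
Qed.

Lemma scanned_start t r m0 m :
  table m0 3 (iota 0 n) (nth 0 w) -> table m0 (3 + n) (iota 0 n) (B t) ->
  (forall x, m x = if 3 + n + n < x <= 3 + n + n + n + n then 0 else m0 x) ->
  layout t r -> r r_pos = 0 -> r r_answer = 1 -> scanned t 0 r m.
Proof.
move=> word bounds mE lay r_p r_ans; split=> //.
  by have := prefix_bound_le w Sigma_neq0 t.+1 0; rewrite r_ans /=; lia.
split=> [i i_in|i i_in|a|d]; rewrite mE.
- by rewrite ifF ?word //; move: i_in; rewrite mem_iota; lia.
- by rewrite ifF ?bounds //; move: i_in; rewrite mem_iota; lia.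
- by rewrite mem_iota => ?; rewrite ifT //; lia.
- rewrite mem_iota => d_range; rewrite ifT; last by lia.
  by rewrite (@eq_count _ _ pred0) ?count_pred0 // => a /=; lia.
Qed.

Lemma runs_play_round t r m : t <= n -> played t r m ->
  runs b play_round (32 * n + 8) r m (played t.+1).
Proof.
move=> le_tn [lay _ word bounds].
pose at_distance d : assertion := fun r' m' =>
  r' r_pos + d = n /\ scanned t (r' r_pos) r' m'.
apply: (runs_weaken (T' := ((n + n) * 5 + (n * 22 + 3).+4).+1)); first by lia.
case: (lay) => *; run_add; apply: (runs_clear_loop (t := t)) => //.
move=> r1 m1 lay1 m1E; run_const; run_const.
apply: (runs_until b_gt0 (Inv := at_distance)) => [d r' m'|d r' m'|r' m'|].
- by move=> [at_d [[]]] *; lia.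
- move=> [at_d [lay' r_p r_ans tables]].
  apply: runs_conseq (runs_scan_letter (t := t) (p := r' r_pos) _ _) => //.
  + by move=> r2 m2 [lay2 r2_p r2_ans tables2]; split; rewrite r2_p //; lia.
  + by lia.
  + by split=> //; exact: layout_flag.
- move=> [at_n [lay' _ ans [word' bounds' _ _]]].
  have {}at_n : r' r_pos = n by lia.
  case: (lay') => *; run_add; apply: runs_nil; split=> //.
  + by case: lay'; split; rewrite // /upd /=; lia.
  + by rewrite -at_n.
  + by apply: eq_table bounds' _ => i; rewrite mem_iota at_n => /andP [_ ->].
- split=> //; apply: scanned_start word bounds m1E _ _ _ => //.
  by case: lay1.
Qed.

Lemma runs_deletion_code : k <= n ->
  runs b deletion_code (k.+1 * (32 * n + 11) + 15) (fun=> 0)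
    (nth 0 [:: n, sigma, k & w]) (fun r _ => r r_answer = (B k.+1 n).-1).
Proof.
move=> le_kn; set c := B k.+1 n.
have c_range : 0 < c <= n.+1 by rewrite prefix_bound_le.
pose to_play d : assertion := fun r m =>
  r r_round + d = k.+1 /\ played (r r_round) r m.
apply: (runs_weaken (T' := (k.+1 * (32 * n + 8).+3 + 3).+4.+4.+4)).
  by lia.
run_const; run_read; first reflexivity.
run_read; first reflexivity.
run_const; run_read; first reflexivity.
run_add; run_const; do 5 run_add.
apply: (runs_until b_gt0 (Inv := to_play)) => [d r m|d r m|r m|].
- by move=> [at_t [[]]] *; lia.
- move=> [at_t [lay ans word bounds]].
  apply: runs_conseq (runs_play_round (t := r r_round) _ _) => //.
  + move=> r' m' [lay' *]; have round' := layout_round lay'.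
    by split; rewrite round' //; lia.
  + by lia.
  + by split=> //; exact: layout_flag.
- move=> [at_t [lay ans _ _]]; have {}at_t : r r_round = k.+1 by lia.
  rewrite at_t -/c in ans; case: (lay) => *; run_sub.
  by apply: runs_nil; rewrite /upd /= subn1.
- split=> //; split=> // i; rewrite mem_iota => /andP [_ lt_i] //.
  by rewrite nth_default //=; lia.
Qed.

End Correctness.

Theorem theorem4 :
  exists (P : program) (e C : nat),
  forall (w : seq nat) (n sigma k iw : nat),
    size w = n ->
    alph w =i iota 1 sigma ->
    1 < sigma ->
    sigma <= n ->
    universality_index (alph w) w iw ->
    k <= iw ->
    iw <= n %/ sigma ->
    exists m : nat,
      min_deletions (iota 1 sigma) w k m /\
      computes_within (word_length e n) P [:: n, sigma, k & w]
        (C * (n * maxn 1 k)) m.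
Proof.
exists (compile deletion_code 0), 4, 100 => w n sigma k iw <-{n}.
move=> alph_w sigma_gt1 le_sn [univ_w _] le_k le_iw.
set n := size w in le_sn le_iw *.
have sigma_range : 0 < sigma <= n by rewrite ltnW.
have Sigma_neq0 : iota 1 sigma != [::] by rewrite -size_eq0 size_iota; lia.
have w_letters : {subset w <= iota 1 sigma}.
  by move=> a; rewrite -alph_w mem_undup.
have word_fits : 4 * n + 4 < 2 ^ word_length 4 n.
  by rewrite /word_length expnD; have := trunc_log_ltn n (isT : 1 < 2); lia.
have le_kn : k <= n := leq_trans le_k (leq_trans le_iw (leq_div n sigma)).
exists (prefix_bound (iota 1 sigma) w k.+1 n).-1; split.
  apply: min_deletions_prefix_bound => //.
  apply: universal_leq le_k _ => // v sz_v sub_v.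
  by apply: univ_w => // a /sub_v; rewrite alph_w.
apply: runs_computes; apply: runs_weaken (runs_deletion_code _ _ _ le_kn) => //.
by nia.
Qed.
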